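(* Let $n\ge 2$ and $G = SD_{8n} = \langle x, y : x^{4n} = y^2 = 1,\ yxy = x^{2n -1}\rangle$. Then $E(\mathcal{CCC}(G)) \leq LE^+(\mathcal{CCC}(G)) \leq LE(\mathcal{CCC}(G))$, and in each of these two inequalities equality holds if and only if $n = 3$.
   Context: For a finite non-abelian group $G$, the commuting conjugacy class graph $\mathcal{CCC}(G)$ is the simple undirected graph whose vertices are the conjugacy classes of the non-central elements of $G$; two distinct vertices $x^G$ and $y^G$ are adjacent iff there exist $x'\in x^G$ and $y'\in y^G$ with $x'y'=y'x'$. For a finite graph $\mathcal{G}$ with adjacency matrix $A(\mathcal{G})$ and (diagonal) degree matrix $D(\mathcal{G})$, put $L(\mathcal{G})=D(\mathcal{G})-A(\mathcal{G})$ and $Q(\mathcal{G})=D(\mathcal{G})+A(\mathcal{G})$, and let $\mathrm{Spec}(\mathcal{G})$, $\mathrm{L\text{-}Spec}(\mathcal{G})$, $\mathrm{Q\text{-}Spec}(\mathcal{G})$ be the multisets of eigenvalues of $A(\mathcal{G})$, $L(\mathcal{G})$, $Q(\mathcal{G})$. With $d=\frac{2|e(\mathcal{G})|}{|V(\mathcal{G})|}$ ($|V(\mathcal{G})|$ the number of vertices, $|e(\mathcal{G})|$ the number of edges), the energy, Laplacian energy and signless Laplacian energy are $E(\mathcal{G})=\sum_{\lambda\in \mathrm{Spec}(\mathcal{G})}|\lambda|$, $LE(\mathcal{G})=\sum_{\mu\in \mathrm{L\text{-}Spec}(\mathcal{G})}|\mu-d|$, $LE^+(\mathcal{G})=\sum_{\nu\in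 \mathrm{Q\text{-}Spec}(\mathcal{G})}|\nu-d|$ (sums with multiplicity). *)

(* Defs.v *)
From mathcomp Require Import all_boot all_order all_algebra all_fingroup all_solvable.

Set Implicit Arguments.
Unset Strict Implicit.
Unset Printing Implicit Defensive.

Import Order.TTheory GRing.Theory Num.Theory.

Record sgraph := SGraph {
  vertex :> finType;
  adj : rel vertex;
  adj_sym : symmetric adj;
  adj_irr : irreflexive adj
}.

Definition edges (X : sgraph) : {set {set X}} :=
  [set [set u; v] | u in X, v in X & adj u v].

Definition degree (X : sgraph) (u : X) : nat := #|[set v : X | adj u v]|.

Section Energies.

Local Open Scope ring_scope.

(* An algebraically closed numeric field such as the complex numbers or algC;
   its order compares only numbers with the same imaginary part, which is
   harmless below, since sums of norms are real. *)
Variable C : numClosedFieldType.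

(* Eigenvalues with algebraic multiplicity: the roots of the characteristic
   polynomial, listed with multiplicity (in an unspecified order). *)
Definition spec m (A : 'M[C]_m) : seq C :=
  sval (closed_field_poly_normal (char_poly A)).

Lemma spec_char_poly m (A : 'M[C]_m) :
  char_poly A = \prod_(z <- spec A) ('X - z%:P).
Proof.
rewrite /spec; case: closed_field_poly_normal => s /= {1}->.
by rewrite (monicP (char_poly_monic A)) scale1r.
Qed.

Variable X : sgraph.

Definition adjmx : 'M[C]_#|X| :=
  \matrix_(i, j) (adj (enum_val i : X) (enum_val j))%:R.

Definition degmx : 'M[C]_#|X| :=
  diag_mx (\row_i (degree (enum_val i : X))%:R).

Definition laplacian : 'M[C]_#|X| := degmx - adjmx.

Definition signless_laplacian : 'M[C]_#|X| := degmx + adjmx.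

Definition avg_degree : C := (2 * #|edges X|)%:R / #|X|%:R.

Definition energy : C := \sum_(z <- spec adjmx) `|z|.

Definition laplacian_energy : C :=
  \sum_(z <- spec laplacian) `|z - avg_degree|.

Definition signless_laplacian_energy : C :=
  \sum_(z <- spec signless_laplacian) `|z - avg_degree|.

End Energies.

Section CommutingConjugacyClassGraph.

Local Open Scope group_scope.

Variables (gT : finGroupType) (G : {group gT}).

Definition noncentral_classes : {set {set gT}} :=
  [set x ^: G | x in G :\: 'Z(G)].

Definition ccc_vertex : finType := {A : {set gT} | A \in noncentral_classes}.

Definition ccc_adj : rel ccc_vertex := fun A B =>
  (A != B) && [exists x in val A, exists y in val B, x * y == y * x].

Lemma ccc_adj_sym : symmetric ccc_adj.
Proof.
suff sub A B : ccc_adj A B -> ccc_adj B A by move=> A B; apply/idP/idP; apply: sub.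
case/andP=> neqAB /exists_inP[x Ax /exists_inP[y By /eqP xy]].
rewrite /ccc_adj eq_sym neqAB; apply/exists_inP; exists y => //.
by apply/exists_inP; exists x => //; rewrite xy.
Qed.

Lemma ccc_adj_irr : irreflexive ccc_adj.
Proof. by move=> A; rewrite /ccc_adj eqxx. Qed.

Definition CCC : sgraph := SGraph ccc_adj_sym ccc_adj_irr.

End CommutingConjugacyClassGraph.

(* Main.v *)
(** Put H = <x>, an abelian subgroup of index 2.  A non-central element of H
    commutes with no element outside H, so the classes inside H form a clique
    that is a connected component.  Every g outside H acts on H as the power
    map h |-> h^(2n-1), so that its centraliser is the union of Z(G) and gZ(G)
    and exactly |Z(G)| classes lie outside H.  If n is even, then |Z(G)| = 2
    and the two outside classes are isolated: the graph is K_{2n-1} + 2 K_1.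
    If n is odd, then |Z(G)| = 4 and any two outside classes contain commuting
    elements, because H is generated by the (2n-2)-nd powers (the translations
    within a class) and Z(G): the graph is K_{2n-2} + K_4.

    On a disjoint union of cliques the three matrices have the form
    diag(t) + s J, with t constant on blocks and J block-wise all ones; by the
    matrix determinant lemma a block of size m contributes the eigenvalues t,
    with multiplicity m - 1, and t + s m.  All energies are therefore images of
    rational numbers, which are compared in the ordered field rat. *)

Require Import Defs.
From mathcomp Require Import all_boot all_order all_algebra all_fingroup all_solvable.
From mathcomp Require Import zify ring lra.

Set Implicit Arguments.
Unset Strict Implicit.
Unset Printing Implicit Defensive.

Import Order.TTheory GRing.Theory Num.Theory.

(** * Determinants and spectra of block-scalar matrices *)

Section GraphEnergies.

Local Open Scope ring_scope.

(** The matrix determinant lemma: the block matrix with rows [D, - U] and [V, 1] is factored into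
    block triangular matrices in two ways, and the determinants are compared. *)
Lemma det_add_mulmx (R : comUnitRingType) m k (D : 'M[R]_m) (U : 'M[R]_(m, k))
    (V : 'M[R]_(k, m)) :
  D \in unitmx -> \det (D + U *m V) = \det D * \det (1%:M + V *m invmx D *m U).
Proof.
move=> uD; have := erefl (\det (block_mx D (- U) V 1%:M)).
have {1}->: block_mx D (- U) V 1%:M =
    block_mx (D + U *m V) (- U) 0 1%:M *m block_mx 1%:M 0 V 1%:M.
  by rewrite mulmx_block !(mul0mx, mulmx0, mulmx1, mul1mx) mulNmx addrK !add0r.
have {1}->: block_mx D (- U) V 1%:M = block_mx D 0 V 1%:M *m
    block_mx 1%:M (- (invmx D *m U)) 0 (1%:M + V *m invmx D *m U).
  rewrite mulmx_block !(mul0mx, mulmx0, mulmx1, mul1mx) !mulmxN mulKVmx //.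
  by rewrite !addr0 mulmxA addrCA addNr addr0.
by rewrite !det_mulmx !det_ublock !det_lblock !det1 !(mulr1, mul1r).
Qed.

Section BlockScalar.

Variables (m k : nat) (f : 'I_m -> 'I_k).

(** Labelling indices by [f] avoids sorting them by block. The ring is left general because
    polynomial and fraction entries occur below. *)
Definition block_scalar_mx (R : pzRingType) (a : 'I_k -> R) (s : R) : 'M[R]_m :=
  \matrix_(i, j) (a (f i) *+ (i == j) + s *+ (f i == f j)).

Local Notation mult l := #|[set i | f i == l]|.

(** The non-diagonal part factors through the block indicator matrix, so only a [k] by [k]
    determinant remains; it is diagonal because distinct blocks are disjoint. *)
Lemma det_block_scalar_field (F : fieldType) (a : 'I_k -> F) (s : F) :
    (forall l, a l != 0) ->
  \det (block_scalar_mx a s) = \prod_l (a l ^+ mult l * (1 + s *+ mult l / a l)).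
Proof.
move=> a_neq0.
pose D := diag_mx (\row_i a (f i)); pose D' := diag_mx (\row_i (a (f i))^-1).
pose U : 'M[F]_(m, k) := \matrix_(i, l) (s *+ (f i == l)).
pose V : 'M[F]_(k, m) := \matrix_(l, j) ((f j == l)%:R).
have DD' : D *m D' = 1%:M.
  rewrite /D /D' mulmx_diag -diag_const_mx; congr diag_mx.
  by apply/rowP=> i; rewrite !mxE divff.
have uD : D \in unitmx by case: (mulmx1_unit DD').
have iD : invmx D = D' by rewrite -(mulKmx uD D') DD' mulmx1.
have -> : block_scalar_mx a s = D + U *m V.
  apply/matrixP=> i j; rewrite !mxE eq_sym (bigD1 (f i)) //= big1 => [|l neq_l].
    by rewrite !mxE eqxx mulr1n mulr_natr addr0 (eq_sym (f j)); case: eqP => [->|].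
  by rewrite !mxE eq_sym (negPf neq_l) mul0r.
rewrite det_add_mulmx // iD det_diag.
have -> : 1%:M + V *m D' *m U = diag_mx (\row_l (1 + s *+ mult l / a l)).
  apply/matrixP=> l l'; rewrite !mxE mulrnDl; congr (_ + _).
  transitivity (\sum_(i | f i == l) (a l)^-1 * (s *+ (l == l'))).
    rewrite [RHS]big_mkcond; apply: eq_bigr => i _.
    rewrite mul_mx_diag !mxE; case: eqP => [->|_]; last by rewrite !mul0r.
    by rewrite mul1r.
  rewrite sumr_const [X in _ *+ X](_ : _ = mult l); last by rewrite cardsE.
  by rewrite mulrnAr mulrnAl mulrC mulrnAC.
rewrite det_diag big_split /=; congr (_ * _); last first.
  by apply: eq_bigr => l _; rewrite mxE.
rewrite (partition_big f xpredT) //=; apply: eq_bigr => l _.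
rewrite (eq_bigr (fun=> a l)) => [|i /eqP <-]; last by rewrite mxE.
by rewrite prodr_const; congr (_ ^+ _); rewrite cardsE.
Qed.

Hypothesis f_surj : forall l, exists i, f i = l.

Lemma mult_gt0 l : (0 < mult l)%N.
Proof. by have [i fi] := f_surj l; apply/card_gt0P; exists i; rewrite inE fi. Qed.

(* Computed in the field of fractions, where the diagonal part is invertible. *)
Lemma det_block_scalar (R : idomainType) (a : 'I_k -> R) (s : R) :
    (forall l, a l != 0) ->
  \det (block_scalar_mx a s) =
    \prod_l (a l ^+ (mult l).-1 * (a l + s *+ mult l)).
Proof.
move=> a_neq0; apply/eqP; rewrite -tofrac_eq -det_map_mx.
have -> : map_mx (@tofrac R) (block_scalar_mx a s) =
    block_scalar_mx (fun l => tofrac (a l)) (tofrac s).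
  by apply/matrixP=> i j; rewrite !mxE rmorphD !rmorphMn.
rewrite det_block_scalar_field => [|l]; last by rewrite tofrac_eq0.
rewrite rmorph_prod; apply/eqP; apply: eq_bigr => l _.
rewrite rmorphM rmorphXn rmorphD rmorphMn /=.
(* Since the block is nonempty, one of its factors [a l] can be spent on clearing the denominator;
   this is where surjectivity of [f] enters. *)
have := mult_gt0 l; case: (mult l) => // r _ /=.
rewrite exprSr -mulrA mulrDr mulr1 mulrCA divff ?mulr1 //.
by rewrite tofrac_eq0.
Qed.

(** The characteristic matrix is again block-scalar, over polynomials, with the nonzero but
    non-invertible diagonal entries ['X - (t l)%:P]. *)
Lemma char_poly_block_scalar (R : idomainType) (t : 'I_k -> R) (s : R) :
  char_poly (block_scalar_mx t s) =
    \prod_l (('X - (t l)%:P) ^+ (mult l).-1 * ('X - (t l + s *+ mult l)%:P)).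
Proof.
rewrite /char_poly.
have -> : char_poly_mx (block_scalar_mx t s) =
    block_scalar_mx (fun l => 'X - (t l)%:P) (- s%:P).
  apply/matrixP=> i j; rewrite !mxE mulrnBl polyCD !polyCMn opprD addrA.
  by rewrite mulNrn.
rewrite det_block_scalar => [|l]; last by rewrite polyXsubC_eq0.
by apply: eq_bigr => l _; rewrite polyCD polyCMn mulNrn opprD addrA.
Qed.

(** The list [spec] has no specified order, but the factorisation of the characteristic polynomial
    fixes it up to permutation, which a sum does not see. *)
Lemma big_spec_block_scalar (C : numClosedFieldType) (t : 'I_k -> C) (s : C)
    (g : C -> C) :
  \sum_(z <- spec (block_scalar_mx t s)) g z =
    \sum_l (g (t l) *+ (mult l).-1 + g (t l + s *+ mult l)).
Proof.
pose r := flatten [seq rcons (nseq (mult l).-1 (t l)) (t l + s *+ mult l)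
                  | l <- enum 'I_k].
have perm_r : perm_eq (spec (block_scalar_mx t s)) r.
  apply: prod_XsubC_eq; rewrite -spec_char_poly char_poly_block_scalar.
  rewrite /r big_flatten big_map big_enum; apply: eq_bigr => l _.
  by rewrite big_rcons big_nseq iter_mulr_1.
rewrite (perm_big _ perm_r) /r big_flatten big_map big_enum.
by apply: eq_bigr => l _; rewrite big_rcons big_nseq iter_addr_0.
Qed.

End BlockScalar.

(** * Energies of disjoint unions of cliques *)

Lemma sum_degree (X : sgraph) : (\sum_(u : X) degree u = 2 * #|edges X|)%N.
Proof.
have edgeP (E : {set X}) : reflect (exists u v, adj u v /\ E = [set u; v])
    (E \in edges X).
  apply: (iffP imset2P) => [[u v _]|[u [v [uv ->]]]].
    by rewrite inE => /andP[_ uv] ->; exists u, v.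
  by exists u v; rewrite ?inE.
have adj_neq (u v : X) : adj u v -> u != v.
  by apply: contraTneq => ->; rewrite adj_irr.
(* Double counting of incident pairs: an edge has two ends by irreflexivity, and the edges at [u]
   correspond to its neighbours [v] through [[set u; v]]. *)
transitivity (\sum_(E in edges X) \sum_(u in E) 1)%N; last first.
  rewrite (eq_bigr (fun=> 2)) ?sum_nat_const 1?mulnC // => E.
  by case/edgeP=> u [v [/adj_neq neq_uv ->]]; rewrite sum1_card cards2 neq_uv.
rewrite (exchange_big_dep predT) //=; apply: eq_bigr => u _.
rewrite sum1dep_card /degree -(@card_in_imset _ _ (fun v => [set u; v])) => [|v w].
  apply: eq_card => E; rewrite [in RHS]inE; apply/imsetP/andP.
    case=> v; rewrite inE => uv ->; split; last exact: set21.
    by apply/edgeP; exists u, v.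
  case=> /edgeP[v [w [vw ->]]] /set2P[]->.
    by exists w; rewrite ?inE.
  by exists v; rewrite ?inE 1?adj_sym // setUC.
rewrite !inE => /adj_neq uv /adj_neq uw /setP/(_ v).
by rewrite !inE eqxx orbT eq_sym (negPf uv) => /esym/eqP.
Qed.

Section CliqueUnion.

Variables (X : sgraph) (k : nat) (f : X -> 'I_k).
Hypothesis adjE : forall u v : X, adj u v = (u != v) && (f u == f v).

Local Notation mult l := #|[set u | f u == l]|.

Hypothesis mult_pos : forall l, (0 < mult l)%N.

Lemma degree_clique_union u : degree u = (mult (f u)).-1.
Proof.
rewrite (cardsD1 u [set _ | _]) inE eqxx /=; apply: eq_card => v.
by rewrite !inE adjE ![_ == v]eq_sym [f u == _]eq_sym.
Qed.

Let fe (i : 'I_#|X|) := f (enum_val i).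

Let fe_surj l : exists i, fe i = l.
Proof.
have /card_gt0P[u] := mult_pos l; rewrite inE => /eqP <-.
by exists (enum_rank u); rewrite /fe enum_rankK.
Qed.

Let card_fe l : #|[set i | fe i == l]| = mult l.
Proof.
rewrite -(card_imset _ enum_val_inj); apply: eq_card => u; rewrite inE.
apply/imsetP/idP => [[i]|fu]; first by rewrite inE => ? ->.
by exists (enum_rank u); rewrite ?inE /fe enum_rankK.
Qed.

Let big_spec C t s g := big_spec_block_scalar (C := C) fe_surj t s g.

Let natr_pred_mult (R : pzRingType) l : (mult l).-1%:R = (mult l)%:R - 1 :> R.
Proof. by rewrite -subn1 natrB. Qed.

Variable C : numClosedFieldType.

Let adj_entry (i j : 'I_#|X|) :
  (adj (enum_val i : X) (enum_val j))%:R =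
  1 *+ (fe i == fe j) - 1 *+ (i == j) :> C.
Proof.
rewrite adjE (inj_eq enum_val_inj) /fe; case: (eqVneq i j) => [->|_] /=.
  by rewrite eqxx subrr.
by rewrite subr0.
Qed.

Lemma adjmx_clique_union : adjmx C X = block_scalar_mx fe (fun=> -1) 1.
Proof. by apply/matrixP=> i j; rewrite !mxE adj_entry mulNrn addrC. Qed.

Lemma laplacian_clique_union :
  laplacian C X = block_scalar_mx fe (fun l => (mult l)%:R) (-1).
Proof.
apply/matrixP=> i j; rewrite !mxE adj_entry degree_clique_union -/(fe i).
by rewrite natr_pred_mult mulrnBl opprB addrA subrK mulNrn.
Qed.

Lemma signless_laplacian_clique_union :
  signless_laplacian C X = block_scalar_mx fe (fun l => (mult l)%:R - 2) 1.
Proof.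
apply/matrixP=> i j; rewrite !mxE adj_entry degree_clique_union -/(fe i).
rewrite natr_pred_mult addrCA addrC; congr (_ + _).
by rewrite -mulrnBl -addrA -opprD.
Qed.

(** A rational twin of [avg_degree], with the degree sum as numerator; staying in [rat] gives a
    total order for the comparisons. *)
Definition mean_degree : rat :=
  (\sum_l mult l * (mult l).-1)%N%:R / (\sum_l mult l)%N%:R.

Lemma avg_degree_clique_union : avg_degree C X = ratr mean_degree.
Proof.
rewrite /avg_degree /mean_degree fmorph_div /= !ratr_nat -sum_degree.
congr (_%:R / _%:R).
  rewrite (partition_big f xpredT) //=; apply: eq_bigr => l _.
  rewrite (eq_bigr (fun=> (mult l).-1)) => [|u /eqP <-].
    by rewrite sum_nat_const cardsE.
  exact: degree_clique_union.
rewrite -sum1_card (partition_big f xpredT) //=; apply: eq_bigr => l _.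
by rewrite sum1_card cardsE.
Qed.

(** A clique of size m has adjacency eigenvalues -1, taken m - 1 times, and m - 1. *)
Lemma energy_clique_union :
  energy C X = ratr (\sum_l (mult l).-1.*2)%N%:R.
Proof.
rewrite /energy adjmx_clique_union big_spec ratr_nat natr_sum.
apply: eq_bigr => l _; rewrite card_fe [-1 + _]addrC -natr_pred_mult.
by rewrite normrN1 normr_nat -natrD addnn.
Qed.

(** A clique of size m has Laplacian eigenvalues m, taken m - 1 times, and 0. *)
Lemma laplacian_energy_clique_union :
  laplacian_energy C X = ratr (\sum_l
    (`|(mult l)%:R - mean_degree| *+ (mult l).-1 + `|mean_degree|)).
Proof.
rewrite /laplacian_energy laplacian_clique_union.
rewrite (big_spec _ _ (fun z => `|z - _|)) rmorph_sum; apply: eq_bigr => l _ /=.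
rewrite card_fe avg_degree_clique_union rmorphD rmorphMn /= !ratr_norm.
by rewrite rmorphB /= ratr_nat mulNrn subrr sub0r normrN.
Qed.

(** A clique of size m has signless Laplacian eigenvalues m - 2, taken m - 1 times, and 2m - 2. *)
Lemma signless_laplacian_energy_clique_union :
  signless_laplacian_energy C X = ratr (\sum_l
    (`|(mult l)%:R - 2 - mean_degree| *+ (mult l).-1
     + `|(mult l)%:R *+ 2 - 2 - mean_degree|)).
Proof.
rewrite /signless_laplacian_energy signless_laplacian_clique_union.
rewrite (big_spec _ _ (fun z => `|z - _|)) rmorph_sum; apply: eq_bigr => l _ /=.
rewrite card_fe avg_degree_clique_union rmorphD rmorphMn /= !ratr_norm.
by rewrite !rmorphB !rmorphMn /= rmorph1 [_ - 2 + _%:R]addrAC.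
Qed.

End CliqueUnion.

(** * Comparison of the energies for the two shapes of graph *)

(* x stands for n, d for the average degree; the sign of 2x - 3 - d is different
   at x = 2. *)
Lemma two_points_energy_ineq (F : realFieldType) (x d : F) :
    x = 2 \/ 4 <= x -> d * (2 * x + 1) = (2 * x - 1) * (2 * x - 2) ->
  let E := 4 * x - 4 in
  let LEp := `|2 * x - 3 - d| * (2 * x - 2) + `|4 * x - 4 - d| + 2 * `|d| in
  let LE := `|2 * x - 1 - d| * (2 * x - 2) + 3 * `|d| in
  E < LEp < LE.
Proof.
case=> [->|x_ge4] dE /=.
  have -> : d = 6 / 5 by lra.
  rewrite ltr0_norm ?ger0_norm; lra.
have x_pos : 0 < 2 * x + 1 by lra.
(* Once the signs are fixed, the equation for [d] reduces [LEp] to [4 * d] and [LE] to [6 * d], so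
   [E < LEp] is exactly this bound; together with the next one it settles the signs. *)
have d_ge : x - 1 < d by rewrite -(ltr_pM2r x_pos) dE; nra.
have d_le : d <= 2 * x - 3 by rewrite -(ler_pM2r x_pos) dE; nra.
rewrite !ger0_norm; lra.
Qed.

(* Here 6 - d changes sign between x = 5 and x = 7. *)
Lemma two_cliques_energy_ineq (F : realFieldType) (x d : F) :
    x = 5 \/ 7 <= x -> d * (x + 1) = 2 * x ^+ 2 - 5 * x + 9 ->
  let E := 4 * x in
  let LEp := `|2 * x - 4 - d| * (2 * x - 3) + `|4 * x - 6 - d|
             + (`|2 - d| * 3 + `|6 - d|) in
  let LE := `|2 * x - 2 - d| * (2 * x - 3) + `|d| + (`|4 - d| * 3 + `|d|) in
  E < LEp < LE.
Proof.
case=> [->|x_ge7] dE /=.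
  have -> : d = 17 / 3 by lra.
  rewrite [`|2 - _|]ler0_norm ?[`|4 - _|]ler0_norm; try lra.
  rewrite !ger0_norm; lra.
have x_pos : 0 < x + 1 by lra.
(* Division gives d = 2x - 7 + 16/(x + 1), the source of these bounds. With the signs fixed, [LEp]
   is [8 * d - 24] and [LE] is [10 * d - 24]. *)
have d_ge : 2 * x - 7 < d by rewrite -(ltr_pM2r x_pos) dE; lra.
have d_ge6 : 6 <= d by rewrite -(ler_pM2r x_pos) dE; nra.
have d_le : d <= 2 * x - 4 by rewrite -(ler_pM2r x_pos) dE; lra.
rewrite [`|2 - d|]ler0_norm ?[`|6 - d|]ler0_norm ?[`|4 - d|]ler0_norm; try lra.
rewrite !ger0_norm; lra.
Qed.

Lemma energies_clique_two_points (C : numClosedFieldType) (n : nat) (X : sgraph)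
    (f : X -> 'I_3) :
    (1 < n)%N -> ~~ odd n ->
    (forall u v : X, adj u v = (u != v) && (f u == f v)) ->
    #|[set u | f u == ord0]| = (2 * n - 1)%N ->
    (forall l, l != ord0 -> #|[set u | f u == l]| = 1%N) ->
  energy C X < signless_laplacian_energy C X < laplacian_energy C X.
Proof.
move=> n_gt1 even_n adjE mult0 mult1.
have mult_pos l : (0 < #|[set u | f u == l]|)%N.
  by case: (eqVneq l ord0) => [->|/mult1->//]; rewrite mult0; lia.
pose x : rat := n%:R; pose d := mean_degree f.
have m0E : (2 * n - 1)%N%:R = 2 * x - 1 :> rat by rewrite natrB ?natrM //; lia.
have m0E' : (2 * n - 1).-1%:R = 2 * x - 2 :> rat.
  by rewrite -subn1 -subnDA natrB ?natrM //; lia.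
have x_case : x = 2 \/ 4 <= x.
  have [n2|n_neq2] := eqVneq n 2; [by left; rewrite /x n2 | right].
  by rewrite /x (ler_nat _ 4 n); lia.
have dE : d * (2 * x + 1) = (2 * x - 1) * (2 * x - 2).
  rewrite /d /mean_degree !big_ord_recl !big_ord0 mult0 !mult1 //=.
  rewrite !muln0 !addn0 natrM natrD m0E m0E'.
  have -> : 2 * x - 1 + (1 + 1)%N%:R = 2 * x + 1 by ring.
  rewrite divfK // lt0r_neq0 //.
  by case: x_case => [->|?]; lra.
have /= := two_points_energy_ineq x_case dE.
rewrite (energy_clique_union adjE) // (laplacian_energy_clique_union adjE) //.
rewrite (signless_laplacian_energy_clique_union adjE) // !ltr_rat -/d.
rewrite !big_ord_recl !big_ord0 mult0 !mult1 //= !mulr0n.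
rewrite -![`|_| *+ _.-1]mulr_natr -addnn !addn0 natrD m0E m0E'.
have -> : 2 * x - 1 - 2 - d = 2 * x - 3 - d by ring.
have -> : (2 * x - 1) *+ 2 - 2 - d = 4 * x - 4 - d by ring.
have -> : 1 *+ 2 - 2 - d = - d by ring.
rewrite normrN => ineq.
by congr (_ && _): ineq; congr (_ < _); ring.
Qed.

Lemma energies_two_cliques (C : numClosedFieldType) (n : nat) (X : sgraph)
    (f : X -> 'I_2) :
    (1 < n)%N -> odd n ->
    (forall u v : X, adj u v = (u != v) && (f u == f v)) ->
    #|[set u | f u == ord0]| = (2 * n - 2)%N ->
    #|[set u | f u == ord_max]| = 4%N ->
  (n != 3%N -> energy C X < signless_laplacian_energy C X < laplacian_energy C X)
  /\ (n = 3%N -> energy C X = signless_laplacian_energy C X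
                 /\ signless_laplacian_energy C X = laplacian_energy C X).
Proof.
move=> n_gt1 odd_n adjE mult0 mult1.
have ord_maxE : lift ord0 ord0 = ord_max :> 'I_2 by apply: val_inj.
have mult_pos l : (0 < #|[set u | f u == l]|)%N.
  by case: (unliftP ord0 l) => [j|] ->; rewrite ?(ord1 j) ?ord_maxE ?mult0 ?mult1; lia.
pose x : rat := n%:R; pose d := mean_degree f.
have m0E : (2 * n - 2)%N%:R = 2 * x - 2 :> rat by rewrite natrB ?natrM //; lia.
have m0E' : (2 * n - 2).-1%:R = 2 * x - 3 :> rat.
  by rewrite -subn1 -subnDA natrB ?natrM //; lia.
have x_ge2 : 2 <= x by rewrite /x (ler_nat _ 2 n).
have dE : d * (x + 1) = 2 * x ^+ 2 - 5 * x + 9.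
  rewrite /d /mean_degree !big_ord_recl !big_ord0 ord_maxE mult0 mult1 //=.
  rewrite !addn0 !natrD natrM m0E m0E'.
  field.
  by rewrite lt0r_neq0 //; lra.
rewrite (energy_clique_union adjE) // (laplacian_energy_clique_union adjE) //.
rewrite (signless_laplacian_energy_clique_union adjE) // !ltr_rat -/d.
have -> : (\sum_l #|[set u | f u == l]|.-1.*2)%N%:R = 4 * x :> rat.
  rewrite !big_ord_recl big_ord0 ord_maxE mult0 mult1.
  rewrite -addnn 2!natrD m0E' (_ : (4.-1.*2 + 0)%N = 6%N) //; ring.
rewrite !big_ord_recl !big_ord0 ord_maxE mult0 mult1.
rewrite -![`|_| *+ _.-1]mulr_natr m0E m0E' [4.-1%:R](_ : _ = 3) // !addr0.
have -> : 2 * x - 2 - 2 - d = 2 * x - 4 - d by ring.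
have -> : (2 * x - 2) *+ 2 - 2 - d = 4 * x - 6 - d by ring.
have -> : 4 - 2 - d = 2 - d by ring.
have -> : 4 *+ 2 - 2 - d = 6 - d by ring.
split=> [n_neq3|n3].
  have x_case : x = 5 \/ 7 <= x.
    have [n5|n_neq5] := eqVneq n 5; [by left; rewrite /x n5 | right].
    by rewrite /x (ler_nat _ 7 n); lia.
  have /= ineq := two_cliques_energy_ineq x_case dE.
  by congr (_ && _): ineq; congr (_ < _); ring.
have x3 : x = 3 by rewrite /x n3.
(* The graph is now two copies of K_4, hence regular: Q - d and d - L both equal A, so the three
   energies coincide. *)
have d3 : d = 3 by move: dE; rewrite x3; lra.
by rewrite x3 d3; split; congr ratr; apply/eqP.
Qed.

End GraphEnergies.

(** * From the presentation to generators of known order; arithmetic modulo 4n *)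

Section SemidihedralGroup.

Local Open Scope group_scope.

(** As [e] squares to 1 modulo [q], the e-th power map is an automorphism of the cyclic group of
    order [q] whose order divides 2, as the semidirect product requires. *)
Lemma Grp_involutive_extension q e : 1 < q -> (e * e = 1 %[mod q])%N ->
  [set: Extremal.gtype q 2 e]
    \isog Grp (x : y : x ^+ q, y ^+ 2, x ^ y = x ^+ e).
Proof.
move=> q_gt1 ee1; apply: Extremal.Grp => //.
have oq : #[Zp1 : 'Z_q] = q by rewrite order_Zp1 Zp_cast.
have ee1R : (e%:R * e%:R = 1 :> 'Z_#[Zp1 : 'Z_q])%R.
  by rewrite -natrM; apply: val_inj; rewrite /= !val_Zp_nat oq // Zp_cast.
have unit_e : (e%:R : 'Z_#[Zp1 : 'Z_q])%R \in GRing.unit.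
  by apply/unitrPr; exists e%:R%R.
pose u := FinRing.unit ('Z_#[Zp1 : 'Z_q]) unit_e.
exists (Zp_unitm u).
rewrite Aut_aut order_injm ?injm_Zp_unitm ?in_setT //; split=> //.
  by rewrite order_dvdn -val_eqE /= ee1R.
apply/eqP; rewrite autE ?cycle_id // eq_expg_mod_order /= !val_Zp_nat oq //.
by rewrite modn_mod.
Qed.

(** The relations bound the order of [G] only from above; the semidirect product satisfies them, so
    it is an image of [G] and gives the lower bound 8n. *)
Lemma semidihedral_generators n (gT : finGroupType) (G : {group gT}) :
  1 < n ->
  G \isog Grp (x : y : x ^+ (4 * n)%N = y ^+ 2 = 1,
                       y * x * y = x ^+ (2 * n - 1)%N) ->
  exists x y, [/\ <[x]> * <[y]> = G, #[x] = (4 * n)%N, #[y] = 2,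
                  y \notin <[x]> & x ^ y = x ^+ (2 * n - 1)%N].
Proof.
move=> n_gt1 isoG; set q := (4 * n)%N; set e := (2 * n - 1)%N.
have q_gt1 : 1 < q by rewrite /q; lia.
have ee1 : (e * e = 1 %[mod q])%N.
  have -> : (e * e = (n - 1) * q + 1)%N by rewrite /e /q; nia.
  by rewrite modnMDl.
have cardD := @Extremal.card q 2 e isT q_gt1.
have : [set: Extremal.gtype q 2 e] \homg G.
  rewrite (isoG _ [set: Extremal.gtype q 2 e]).
  have /isoGrp_hom/existsP[[x y]] := Grp_involutive_extension q_gt1 ee1.
  rewrite /= !xpair_eqE => /and4P[defD xq /eqP y2 xy].
  apply/existsP; exists (x, y); rewrite /= !xpair_eqE defD xq y2 eqxx /=.
  have yV : y^-1 = y by apply/eqP; rewrite eq_invg_mul -expg2 y2.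
  by rewrite -{1}yV -mulgA -conjgE (eqP xy).
move/leq_homg; rewrite cardD => leDG.
have /existsP[[x y]] := isoGrp_hom isoG.
rewrite /= !xpair_eqE => /and4P[/eqP defG /eqP xq /eqP y2 /eqP yxy].
exists x, y.
have yV : y^-1 = y by apply/eqP; rewrite eq_invg_mul -expg2 y2.
have xy : x ^ y = x ^+ e by rewrite conjgE yV mulgA.
have nxy : <[y]> \subset 'N(<[x]>) by rewrite norms_cycle xy mem_cycle.
have defG' : <[x]> * <[y]> = G by rewrite -norm_joinEr.
have ox : #[x] <= q by rewrite dvdn_leq ?order_dvdn ?xq //; lia.
have oy : #[y] <= 2 by rewrite dvdn_leq // order_dvdn y2.
have := mul_cardG <[x]> <[y]>; rewrite defG' -!orderE => cardG.
have I_gt0 := cardG_gt0 (<[x]> :&: <[y]>).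
(* Squeeze: [#[x] * #[y]] is at most 2q and equals the order of [G], at least 2q, times that of the
   intersection. *)
have [oxE oyE cI] : [/\ #[x] = q, #[y] = 2 & #|<[x]> :&: <[y]>| = 1%N].
  have oxy : (#[x] * #[y] <= q * 2)%N by rewrite leq_mul.
  have cI : #|<[x]> :&: <[y]>| = 1%N.
    apply/eqP; rewrite eqn_leq I_gt0 andbT -(leq_pmul2l (_ : 0 < 2 * q)%N).
      rewrite muln1; apply: (@leq_trans (#[x] * #[y])); last by rewrite (mulnC 2).
      by rewrite cardG leq_mul2r leDG orbT.
    by rewrite muln_gt0 (ltnW q_gt1).
  rewrite cI muln1 in cardG.
  have oxy_ge : (q * 2 <= #[x] * #[y])%N by rewrite cardG mulnC.
  by split=> //; nia.
split=> //; apply/negP=> yx.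
by move: cI; rewrite (setIidPr _) ?cycle_subG // -orderE oyE.
Qed.

Lemma card_uniform_classes (gT : finGroupType) (G : {group gT}) (D : {set gT}) c :
    G \subset 'N(D) -> {in D, forall u, #|u ^: G| = c} ->
  (#|[set u ^: G | u in D]| * c)%N = #|D|.
Proof.
move=> nDG cardD.
have actsG : [acts G, on D | 'J] by rewrite astabsJ.
have partD : partition [set u ^: G | u in D] D := orbit_partition actsG.
by rewrite -(card_uniform_partition _ partD) // => A /imsetP[u /cardD <- ->].
Qed.

(** The difference is 2ni(n - 2), with n - 2 even. It exhibits the central element
    [x ^+ (2 * n * i)] as a (2n-2)-nd power. *)
Lemma modn_even_double n i : 1 < n -> ~~ odd n ->
  (n * i * (2 * n - 2) = 2 * n * i %[mod 4 * n])%N.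
Proof.
move=> n_gt1 even_n; have [k ->] : exists k, n = (2 * k.+1)%N by exists n./2.-1; lia.
have -> : (2 * (2 * k.+1) - 2 = 4 * k + 2)%N by lia.
have -> : (2 * k.+1 * i * (4 * k + 2) =
           i * k * (4 * (2 * k.+1)) + 2 * (2 * k.+1) * i)%N.
  by lia.
by rewrite modnMDl.
Qed.

(** For odd n both 2 and n - 1 are coprime to n; the relation is stated additively to avoid
    truncated subtraction. *)
Lemma bezout_odd n : 1 < n -> odd n ->
  exists k l, ((2 * n - 2) * k = n * l + 1)%N.
Proof.
move=> n_gt1 odd_n; have m_gt0 : (0 < 2 * n - 2)%N by lia.
have : coprime (2 * n - 2) n.
  rewrite -[X in (_ - X)%N]muln1 -mulnBr coprimeMl coprime2n odd_n subn1.
  by rewrite coprimePn // ltnW.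
by case/(coprimeP _ m_gt0)=> -[k l] /= kl; exists k, l; lia.
Qed.

(** * Counting vertices of the commuting conjugacy class graph *)

Section Vertices.

Variables (gT : finGroupType) (G : {group gT}).

Lemma ccc_vertexP (u : CCC G) : exists2 a, a \in G :\: 'Z(G) & val u = a ^: G.
Proof. by case: u => A /= /imsetP[a ? ->]; exists a. Qed.

Lemma card_ccc_sub (D : {set gT}) c :
    D \subset G :\: 'Z(G) -> G \subset 'N(D) ->
    {in D, forall a, #|a ^: G| = c} ->
  (#|[set u : CCC G | val u \subset D]| * c)%N = #|D|.
Proof.
move=> sDG nDG /(card_uniform_classes nDG) <-; congr (_ * c)%N.
rewrite -(card_imset _ val_inj); apply: eq_card => A.
apply/imsetP/imsetP => [[u]|[a aD ->]].
  have [a _ /= def_u] := ccc_vertexP u; rewrite inE /= def_u class_sub_norm //.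
  by exists a.
have aV : a ^: G \in noncentral_classes G by apply/imset_f/(subsetP sDG).
by exists (Sub (a ^: G) aV); rewrite ?SubK // inE /= class_sub_norm.
Qed.

End Vertices.

(** * Centre, centralisers and class sizes *)

Section Semidihedral.

Variables (gT : finGroupType) (G : {group gT}) (x y : gT) (n : nat).
Hypotheses (n_gt1 : 1 < n) (defG : <[x]> * <[y]> = G).
Hypotheses (ox : #[x] = (4 * n)%N) (oy : #[y] = 2) (yNx : y \notin <[x]>).
Hypothesis (xy : x ^ y = x ^+ (2 * n - 1)%N).

Local Notation H := <[x]>.

Let sHG : H \subset G. Proof. by rewrite -defG mulG_subl. Qed.
Let Gx : x \in G. Proof. by rewrite (subsetP sHG) ?cycle_id. Qed.
Let Gy : y \in G.
Proof. by rewrite -defG -{1}[y]mul1g mem_mulg ?group1 ?cycle_id. Qed.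

Let cHH g h : g \in H -> h \in H -> commute g h.
Proof. by move=> Hg Hh; apply: (centsP (cycle_abelian x)). Qed.

Let oH : #|H| = (4 * n)%N. Proof. by rewrite -orderE. Qed.
Let oG : #|G| = (2 * (4 * n))%N.
Proof.
rewrite -defG TI_cardMg -?orderE ?ox ?oy 1?mulnC // setIC.
by apply: prime_TIg; rewrite ?cycle_subG // -orderE oy.
Qed.

Lemma outside_cycleP g : g \in G :\: H -> exists2 a, a \in H & g = a * y.
Proof.
rewrite !inE -defG => /andP[gNH /mulsgP[a b Ha]].
rewrite [<[y]>]cycle2g // !inE => /orP[] /eqP-> defg; last by exists a.
by rewrite defg mulg1 Ha in gNH.
Qed.

Lemma conj_outside g h : g \in G :\: H -> h \in H -> h ^ g = h ^+ (2 * n - 1).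
Proof.
case/outside_cycleP=> a Ha -> Hh; rewrite conjgM (conjgE h a) -(cHH Ha Hh) mulKg.
by case/cycleP: Hh => i ->; rewrite conjXg xy -!expgM mulnC.
Qed.

Lemma divg_outside g w : g \in G :\: H -> w \in G :\: H -> g^-1 * w \in H.
Proof.
case/outside_cycleP=> a Ha ->; case/outside_cycleP=> b Hb ->.
rewrite invMg mulgA -(mulgA y^-1) -mulgA -conjgE.
have /cycleP[i ->] : a^-1 * b \in H by rewrite groupM ?groupV.
by rewrite conjXg xy -expgM mem_cycle.
Qed.

Let nHG : G \subset 'N(H).
Proof.
by rewrite -defG mul_subG // ?norms_cycle ?cycle_norm ?xy ?mem_cycle // normG.
Qed.

(** All elements outside [H] induce the same power map on [H], so an element of [H] fixed by one of
    them is fixed by all. *)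
Lemma commute_outside g h : g \in G :\: H -> h \in H -> commute g h ->
  h \in 'Z(G).
Proof.
move=> gH Hh cgh; apply/centerP; split=> [|w]; first exact: (subsetP sHG).
move=> Gw; case: (boolP (w \in H)) => [Hw|wNH]; first exact: cHH.
have wH : w \in G :\: H by rewrite inE wNH.
apply/commgP/conjg_fixP; rewrite (conj_outside wH Hh) -(conj_outside gH Hh).
by rewrite conjgE -cgh mulKg.
Qed.

Lemma center_sub_cycle : 'Z(G) \subset H.
Proof.
apply/subsetP=> z /centerP[Gz cz]; apply/negPn/negP=> zNH.
have zH : z \in G :\: H by rewrite inE zNH.
have := conj_outside zH (cycle_id x); rewrite conjgE -(cz x Gx) mulKg => /eqP.
rewrite -{1}[x]expg1 eq_expg_mod_order ox !modn_small; lia.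
Qed.

(** Commuting with [y] suffices, and it means that 4n divides (2n - 2)i; both sides are then
    halved. *)
Lemma expg_center i : (x ^+ i \in 'Z(G)) = (2 * n %| (n - 1) * i)%N.
Proof.
have yH : y \in G :\: H by rewrite inE yNx.
have Hxi : x ^+ i \in H by rewrite mem_cycle.
transitivity (x ^+ i == x ^+ i ^+ (2 * n - 1)).
  rewrite -(conj_outside yH Hxi) eq_sym; apply/idP/eqP => [/centerP[_ cxi]|xiy].
    by apply/conjg_fixP/commgP/cxi.
  by apply: commute_outside yH Hxi _; apply/esym/commgP/conjg_fixP.
rewrite eq_sym -expgM eq_expg_mod_order ox eqn_mod_dvd; last by nia.
rewrite (_ : (_ - _ = 2 * ((n - 1) * i))%N); last by nia.
by rewrite (_ : (4 * n = 2 * (2 * n))%N) ?dvdn_pmul2l //; lia.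
Qed.

(** For even n, n - 1 is coprime to 2n, so [expg_center] asks that 2n divide i. *)
Lemma center_even : ~~ odd n -> 'Z(G) = <[x ^+ (2 * n)]>.
Proof.
move=> even_n; apply/eqP; rewrite eqEsubset cycle_subG expg_center dvdn_mull //.
rewrite andbT; apply/subsetP=> z Zz.
have /cycleP[i def_z] := subsetP center_sub_cycle z Zz.
move: Zz; rewrite def_z expg_center Gauss_dvdr => [/dvdnP[j ->]|].
  by rewrite mulnC expgM mem_cycle.
rewrite coprimeMl coprime2n oddB ?(ltnW n_gt1) // addbT even_n.
by rewrite subn1 coprimenP // ltnW.
Qed.

(** For odd n, n - 1 is twice [n./2], which is coprime to n, so [expg_center] asks that n divide
    i. *)
Lemma center_odd : odd n -> 'Z(G) = <[x ^+ n]>.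
Proof.
move=> odd_n; have def_n : (n - 1 = 2 * n./2)%N.
  by rewrite -[in LHS](odd_double_half n) odd_n add1n subn1 mul2n.
apply/eqP; rewrite eqEsubset cycle_subG expg_center def_n -mulnA.
rewrite dvdn_pmul2l // dvdn_mull // andbT.
apply/subsetP=> z Zz; have /cycleP[i def_z] := subsetP center_sub_cycle z Zz.
move: Zz; rewrite def_z expg_center def_n -mulnA dvdn_pmul2l //.
rewrite Gauss_dvdr => [/dvdnP[j ->]|].
  by rewrite mulnC expgM mem_cycle.
have : coprime n (n - 1) by rewrite subn1 coprimenP // ltnW.
by rewrite def_n coprimeMr => /andP[].
Qed.

Lemma card_center_even : ~~ odd n -> #|'Z(G)| = 2.
Proof.
have def_4n : (4 * n = 2 * (2 * n))%N by lia.
move=> even_n; rewrite center_even // -orderE orderXdiv ox def_4n.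
  by rewrite mulnK //; lia.
exact: dvdn_mull.
Qed.

Lemma card_center_odd : odd n -> #|'Z(G)| = 4.
Proof.
move=> odd_n; rewrite center_odd // -orderE orderXdiv ox ?dvdn_mull //.
by rewrite mulnK // ltnW.
Qed.

Lemma card_class_inside h : h \in H :\: 'Z(G) -> #|h ^: G| = 2.
Proof.
rewrite inE => /andP[hNZ Hh].
have ch : 'C_G[h] = H.
  apply/setP=> g; rewrite inE; apply/andP/idP=> [[Gg /cent1P cgh]|Hg].
    apply: contraNT hNZ => gNH; apply: (@commute_outside g) => //.
    by rewrite inE gNH.
  by split; [apply: (subsetP sHG) | apply/cent1P/cHH].
by rewrite -index_cent1 ch -divgS // oG oH mulnK //; lia.
Qed.

Lemma cent_outside g : g \in G :\: H -> 'C_G[g] = 'Z(G) :|: g *: 'Z(G).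
Proof.
move=> gH; have /setDP[Gg gNH] := gH; apply/setP=> w; rewrite in_setU mem_lcoset inE.
apply/andP/orP=> [[Gw /cent1P cgw]|].
  have [Hw|wNH] := boolP (w \in H).
    by left; apply: commute_outside gH Hw _.
  have wH : w \in G :\: H by rewrite inE wNH.
  right; apply: (commute_outside gH); first exact: divg_outside.
  by apply: commuteM => //; apply: commuteV.
have ZC z : z \in 'Z(G) -> z \in G /\ z \in 'C[g].
  by case/centerP=> Gz cz; split=> //; apply/cent1P/cz.
case=> [/ZC|] // /ZC[Gz Cz].
by rewrite -(mulKVg g w); split; rewrite groupM ?cent1id.
Qed.

(** The centraliser has order 2|Z(G)|, since the coset of [g] lies outside [H] and so misses the
    centre. *)
Lemma card_class_outside g : g \in G :\: H -> (#|g ^: G| * #|'Z(G)| = 4 * n)%N.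
Proof.
move=> gH; have /setDP[Gg gNH] := gH.
have cC : #|'C_G[g]| = (2 * #|'Z(G)|)%N.
  rewrite cent_outside // cardsU card_lcoset disjoint_setI0.
    by rewrite cards0 subn0 addnn mul2n.
  rewrite disjoint_subset; apply/subsetP=> z Zz; rewrite inE mem_lcoset.
  apply: contra gNH => /(subsetP center_sub_cycle).
  rewrite groupMr ?groupV //.
  exact: (subsetP center_sub_cycle).
have := Lagrange (subsetIl G 'C[g]).
rewrite cC index_cent1 oG -mulnA => /eqP; rewrite eqn_pmul2l // => /eqP <-.
by rewrite mulnC.
Qed.

(** * Vertices inside and outside the cyclic subgroup, and their adjacency *)

Local Notation inside := [pred u : CCC G | val u \subset H].

Lemma insideE (u : CCC G) a : a \in val u -> inside u = (a \in H).
Proof.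
have [b _ /= ->] := ccc_vertexP u => /class_eqP <-.
exact: class_sub_norm.
Qed.

Lemma card_inside : (#|[set u | inside u]| * 2 + #|'Z(G)| = 4 * n)%N.
Proof.
have sZH := center_sub_cycle.
have := card_ccc_sub (G := G) (D := H :\: 'Z(G)) (c := 2).
rewrite setSD // normsD ?gFnorm // => /(_ isT isT card_class_inside) cardD.
have -> : [set u | inside u] = [set u : CCC G | val u \subset H :\: 'Z(G)].
  apply/setP=> u; rewrite !inE; have [a] := ccc_vertexP u.
  case/setDP=> Ga aNZ /= ->; rewrite !class_sub_norm ?normsD ?gFnorm //.
  by rewrite inE aNZ.
rewrite cardD cardsD (setIidPr sZH) oH subnK //.
by rewrite -oH subset_leq_card.
Qed.

(** The outside classes have equal size and fill 4n elements, and that size times |Z(G)| is 4n. *)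
Lemma card_outside : #|[set u | ~~ inside u]| = #|'Z(G)|.
Proof.
have yH : y \in G :\: H by rewrite inE yNx.
have := card_ccc_sub (G := G) (D := G :\: H) (c := #|y ^: G|).
rewrite setDS ?center_sub_cycle // normsD ?normG // => /(_ isT isT).
have Z_gt0 := cardG_gt0 'Z(G).
have eq_card_class : {in G :\: H, forall a, #|a ^: G| = #|y ^: G|}.
  move=> a aH; apply/eqP; rewrite -(eqn_pmul2r Z_gt0).
  by rewrite !card_class_outside.
have -> : [set u : CCC G | val u \subset G :\: H] = [set u | ~~ inside u].
  apply/setP=> u; rewrite !inE; have [a] := ccc_vertexP u.
  case/setDP=> Ga aNZ /= ->; rewrite !class_sub_norm ?normsD ?normG //.
  by rewrite inE Ga andbT.
move=> /(_ eq_card_class); rewrite cardsD (setIidPr sHG) oH oG mul2n -addnn addnK.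
rewrite -(card_class_outside yH) mulnC => /eqP; rewrite eqn_pmul2l ?card_gt0.
  by move/eqP.
by apply/set0Pn; exists y; apply: class_refl.
Qed.

Lemma adj_inside (u v : CCC G) : inside u -> inside v -> adj u v = (u != v).
Proof.
move=> uH vH; rewrite /= /ccc_adj andb_idr // => _.
have [a _ def_u] := ccc_vertexP u; have [b _ def_v] := ccc_vertexP v.
have au : a \in val u by rewrite def_u class_refl.
have bv : b \in val v by rewrite def_v class_refl.
apply/exists_inP; exists a => //; apply/exists_inP; exists b => //.
by apply/eqP/cHH; [rewrite -(insideE au) | rewrite -(insideE bv)].
Qed.

Lemma adj_inside_outside (u v : CCC G) : inside u -> ~~ inside v -> ~~ adj u v.
Proof.
move=> uH vH; apply/nandP; right; apply/exists_inP=> -[a au /exists_inP[b bv /eqP cab]].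
move: vH uH; rewrite (insideE au) (insideE bv) => bNH Ha.
have [c /setDP[Gc cNZ] def_u] := ccc_vertexP u.
have [d /setDP[Gd dNZ] def_v] := ccc_vertexP v.
have bH : b \in G :\: H.
  rewrite inE bNH; move: bv; rewrite def_v => /imsetP[w Gw ->]; exact: groupJ.
have := commute_outside bH Ha (esym cab).
move: au; rewrite def_u => /imsetP[w Gw ->]; rewrite memJ_norm ?(negPf cNZ) //.
by rewrite (subsetP (gFnorm _ _)).
Qed.

(** Conjugation by the inverse of [h] gives [h * g * h^-1], and moving [h] past [g] turns it into
    its (2n-1)-st power. *)
Lemma mulX_class g h : g \in G :\: H -> h \in H -> g * h ^+ (2 * n - 2) \in g ^: G.
Proof.
move=> gH Hh; apply/imsetP; exists h^-1; first by rewrite groupV (subsetP sHG).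
rewrite conjgE invgK mulgA -(mulKVg g (h * g)) -mulgA -conjgE conj_outside //.
have -> : (2 * n - 1 = (2 * n - 2).+1)%N by lia.
by rewrite expgSr mulgK.
Qed.

Let in_outside (u : CCC G) a : a \in val u -> ~~ inside u -> a \in G :\: H.
Proof.
move=> au; rewrite (insideE au) inE => ->.
have [b /setDP[Gb _] def_u] := ccc_vertexP u.
by move: au; rewrite def_u => /imsetP[w Gw ->]; apply: groupJ.
Qed.

(** Commuting outside elements differ by a central factor, which for even n is a translation within
    the class, so they are already conjugate. *)
Lemma adj_outside_even (u v : CCC G) :
  ~~ odd n -> ~~ inside u -> ~~ inside v -> ~~ adj u v.
Proof.
move=> even_n uH vH; apply/negP=> /andP[/eqP neq_uv].
case/exists_inP=> a au /exists_inP[b bv /eqP cab]; case: neq_uv.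
have aH := in_outside au uH; have bH := in_outside bv vH.
have : a^-1 * b \in 'Z(G).
  apply: commute_outside aH (divg_outside aH bH) _.
  by apply: commuteM => //; apply: commuteV.
rewrite center_even // => /cycleP[i def_b].
have : a * x ^+ (n * i) ^+ (2 * n - 2) \in a ^: G by rewrite mulX_class ?mem_cycle.
have -> : x ^+ (n * i) ^+ (2 * n - 2) = x ^+ (2 * n) ^+ i.
  rewrite -!expgM; apply/eqP; rewrite eq_expg_mod_order ox.
  exact/eqP/modn_even_double.
rewrite -def_b mulKVg => ba; apply: val_inj.
move: au bv; have [c _ ->] := ccc_vertexP u; have [d _ ->] := ccc_vertexP v.
by move=> /class_eqP <- /class_eqP <-; apply/esym/class_eqP.
Qed.

Lemma adj_outside_odd (u v : CCC G) :
  odd n -> ~~ inside u -> ~~ inside v -> adj u v = (u != v).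
Proof.
move=> odd_n uH vH; rewrite /= /ccc_adj andb_idr // => _.
have [a _ def_u] := ccc_vertexP u; have [b _ def_v] := ccc_vertexP v.
have au : a \in val u by rewrite def_u class_refl.
have bv : b \in val v by rewrite def_v class_refl.
have aH := in_outside au uH; have bH := in_outside bv vH.
have /cycleP[i def_w] := divg_outside aH bH.
have [k [l kl]] := bezout_odd n_gt1 odd_n.
(* With [b = a * x ^+ i], the Bezout relation times i makes this conjugate of [a] equal to [b] times
   a power of the central [x ^+ n]. *)
apply/exists_inP; exists (a * x ^+ (k * i) ^+ (2 * n - 2)).
  by rewrite def_u mulX_class ?mem_cycle.
apply/exists_inP; exists b => //.
have /centerP[_ cz] : x ^+ n ^+ (l * i) \in 'Z(G).
  by rewrite center_odd // mem_cycle.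
have -> : a * x ^+ (k * i) ^+ (2 * n - 2) = b * x ^+ n ^+ (l * i).
  rewrite -(mulKVg a b) def_w -mulgA -!expgM -expgD; congr (_ * x ^+ _).
  by rewrite mulnAC (mulnC k) kl mulnDl mul1n addnC mulnA.
by apply/eqP; rewrite -mulgA cz //; case/setDP: bH.
Qed.

(** * The graph as a union of cliques, and the conclusion *)

Local Open Scope ring_scope.

Lemma energies_semidihedral_even (C : numClosedFieldType) : ~~ odd n ->
  energy C (CCC G) < signless_laplacian_energy C (CCC G) < laplacian_energy C (CCC G).
Proof.
move=> even_n; have cardZ := card_center_even even_n.
have card_out : #|[set u | ~~ inside u]| = 2 by rewrite card_outside.
have /card_gt0P[v0] : (0 < #|[set u | ~~ inside u]|)%N by rewrite card_out.
rewrite inE => v0_out.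
have mult2_card : #|[set u | ~~ inside u] :\ v0| = 1%N.
  by move: card_out; rewrite (cardsD1 v0) inE v0_out => -[].
have /eqP/cards1P[v1 def_v1] := mult2_card.
(* The two outside classes are isolated, so each needs its own label; [v0] is an arbitrary choice of
   one of them. *)
pose f (u : CCC G) : 'I_3 :=
  if inside u then ord0
  else if u == v0 then lift ord0 ord0 else lift ord0 (lift ord0 ord0).
have adjE u v : adj u v = (u != v) && (f u == f v).
  rewrite /f; have [uH|uH] := boolP (inside u); have [vH|vH] := boolP (inside v).
  - by rewrite adj_inside // andbT.
  - by rewrite (negPf (adj_inside_outside uH vH)); case: ifP; rewrite andbF.
  - by rewrite adj_sym (negPf (adj_inside_outside vH uH)); case: ifP; rewrite andbF.
  rewrite (negPf (adj_outside_even even_n uH vH)).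
  have only_v1 w : ~~ inside w -> w != v0 -> w = v1.
    by move=> wH w_neq; apply/set1P; rewrite -def_v1 !inE w_neq.
  have [u_eq|u_neq] := eqVneq u v0; have [v_eq|v_neq] := eqVneq v v0.
  - by rewrite u_eq v_eq eqxx.
  - by rewrite andbF.
  - by rewrite andbF.
  rewrite (only_v1 u uH u_neq) (only_v1 v vH v_neq).
  by rewrite eqxx.
have mult0 : #|[set u | f u == ord0]| = (2 * n - 1)%N.
  rewrite (_ : [set u | _] = [set u | inside u]).
    by have := card_inside; rewrite cardZ; move: #|_| => N; clear; lia.
  by apply/setP=> u; rewrite !inE /f; case: ifP => //; case: ifP.
have mult1 : #|[set u | f u == lift ord0 ord0]| = 1%N.
  rewrite (_ : [set u | _] = [set v0]) ?cards1 //.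
  apply/setP=> u; rewrite !inE /f; case: ifPn => [uH|_]; last by case: ifP.
  by apply/esym; apply: contraNF v0_out => /eqP <-.
have mult2 : #|[set u | f u == lift ord0 (lift ord0 ord0)]| = 1%N.
  rewrite -[RHS]mult2_card; apply: eq_card => u.
  by rewrite !inE /f /=; case: (_ \subset _); case: (u == v0).
apply: (energies_clique_two_points C n_gt1 even_n adjE mult0).
by case=> [[|[|[|//]]]].
Qed.

Lemma energies_semidihedral_odd (C : numClosedFieldType) : odd n ->
  (n != 3%N ->
    energy C (CCC G) < signless_laplacian_energy C (CCC G) < laplacian_energy C (CCC G))
  /\ (n = 3%N -> energy C (CCC G) = signless_laplacian_energy C (CCC G)
                 /\ signless_laplacian_energy C (CCC G) = laplacian_energy C (CCC G)).
Proof.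
move=> odd_n; have cardZ := card_center_odd odd_n.
pose f (u : CCC G) : 'I_2 := if inside u then ord0 else ord_max.
apply: (@energies_two_cliques C n (CCC G) f) => //.
- move=> u v; rewrite /f.
  have [uH|uH] := boolP (inside u); have [vH|vH] := boolP (inside v).
  + by rewrite adj_inside // andbT.
  + by rewrite (negPf (adj_inside_outside uH vH)) andbF.
  + by rewrite adj_sym (negPf (adj_inside_outside vH uH)) andbF.
  by rewrite adj_outside_odd // andbT.
- rewrite (_ : [set u | _] = [set u | inside u]).
    by have := card_inside; rewrite cardZ; move: #|_| => N; clear; lia.
  by apply/setP=> u; rewrite !inE /f; case: ifP.
rewrite -cardZ -card_outside; apply: eq_card => u.
by rewrite !inE /f /=; case: (_ \subset _).
Qed.

End Semidihedral.

End SemidihedralGroup.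

Local Open Scope ring_scope.

Theorem theorem4p5 (C : numClosedFieldType) (n : nat) (gT : finGroupType)
    (G : {group gT}) :
  (2 <= n)%N ->
  (G \isog Grp (x : y : x ^+ (4 * n)%N = y ^+ 2 = 1,
                        y * x * y = x ^+ (2 * n - 1)%N))%g ->
  energy C (CCC G) <= signless_laplacian_energy C (CCC G)
  /\ signless_laplacian_energy C (CCC G) <= laplacian_energy C (CCC G)
  /\ (energy C (CCC G) = signless_laplacian_energy C (CCC G) <-> n = 3%N)
  /\ (signless_laplacian_energy C (CCC G) = laplacian_energy C (CCC G) <-> n = 3%N).
Proof.
move=> n_ge2 /(semidihedral_generators n_ge2)[x [y [defG ox oy yNx xy]]].
(* Away from n = 3 both sides of each equivalence are false, so the two strict inequalities yield
   all four claims. *)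
have strict (E Q L : C) : n != 3%N -> E < Q < L ->
    E <= Q /\ Q <= L /\ (E = Q <-> n = 3%N) /\ (Q = L <-> n = 3%N).
  move=> /eqP n_neq3 /andP[EQ QL]; rewrite !ltW //.
  by do 2!split=> //; split; split=> // eq_e; move: EQ QL; rewrite eq_e ltxx.
have [odd_n|even_n] := boolP (odd n); last first.
  apply: strict; first by apply: contraNneq even_n => ->.
  exact: energies_semidihedral_even n_ge2 defG ox oy yNx xy _ even_n.
have [EQL EQLeq] := energies_semidihedral_odd n_ge2 defG ox oy yNx xy C odd_n.
have [n3|n_neq3] := eqVneq n 3%N; last exact: strict n_neq3 (EQL n_neq3).
by have [-> ->] := EQLeq n3; rewrite !lexx.
Qed.
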